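(* Let $F\subseteq\mathbb{R}^d$ be the attractor of an IFS of homotheties which satisfies the weak separation condition (WSC). Then $F$ is weakly homogeneous.
   Context: $Q=[0,1]^d$. A homothety of $\mathbb{R}^d$ is a map $x\mapsto rx+\alpha$ with $r>0$, $\alpha\in\mathbb{R}^d$; it is contracting if $r<1$ and expanding if $r\ge1$. For a compact $F\subseteq\mathbb{R}^d$, an F-miniset of $F$ is a non-empty compact subset of a set of the form $Q\cap\varphi(F)$ with $\varphi$ an expanding homothety; an F-microset of $F$ is any limit of F-minisets of $F$ in the Hausdorff metric. $F$ is weakly homogeneous if every F-microset of $F$ is a union of finitely many F-minisets of $F$. An IFS of homotheties is a finite non-empty collection $\Phi=\{\varphi_i\}_{i\in\Lambda}$ of contracting homotheties of $\mathbb{R}^d$ with ratios $r_i$; its attractor is the unique non-empty compact set $F$ with $F=\bigcup_{i\in\Lambda}\varphi_i(F)$. For a finite word $i=i_1\dots i_k$ over $\Lambda$ put $\varphi_i=\varphi_{i_1}\circ\dots\circ\varphi_{i_k}$, $r_i=r_{i_1}\cdots r_{i_k}$. For $\rho>0$ let $\Pi_\rho$ be the set of non-empty finite words $i$ with $r_i\le\rho<r_{i_1}\cdots r_{i_{|i|-1}}$ (empty product equal to $1$). $\Phi$ satisfies the WSC if there is $c\in\mathbb{N}$ such that for every $\rho>0$ and every ball $B$ of radius $\rho$, $|\{\varphi_i(F): i\in\Pi_\rho,\ \varphi_i(F)\cap B\ne\emptyset\}|\le c$, where identical sets $\varphi_i(F)=\varphi_j(F)$ with $i\neq j$ are counted only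 once. *)

(* Defs.v *)
From HB Require Import structures.
From mathcomp Require Import all_boot all_order all_algebra.
From mathcomp Require Import all_classical all_reals all_analysis.

Set Implicit Arguments.
Unset Strict Implicit.
Unset Printing Implicit Defensive.

Import Order.TTheory GRing.Theory Num.Theory.
Import numFieldNormedType.Exports.

Local Open Scope classical_set_scope.
Local Open Scope card_scope.
Local Open Scope ring_scope.

(* The library norm on ['rV[R]_d] is the sup norm, so the Euclidean distance is
   defined by hand. Compactness is that of the library topology, which is the
   usual one. *)
Definition eucl_dist (R : realType) (d : nat) (x y : 'rV[R]_d) : R :=
  Num.sqrt (\sum_(i < d) (x ord0 i - y ord0 i) ^+ 2).

Definition eucl_ball (R : realType) (d : nat) (x : 'rV[R]_d) (rho : R) :
    set 'rV[R]_d :=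
  [set y | eucl_dist x y < rho].

Definition dist_to_set (R : realType) (d : nat) (x : 'rV[R]_d)
    (A : set 'rV[R]_d) : \bar R :=
  ereal_inf [set (eucl_dist x y)%:E | y in A].

(* Extended-real valued, hence meaningful for all sets; it is finite on
   non-empty compact sets. *)
Definition hausdorff_dist (R : realType) (d : nat) (A B : set 'rV[R]_d) :
    \bar R :=
  maxe (ereal_sup [set dist_to_set x B | x in A])
       (ereal_sup [set dist_to_set y A | y in B]).

Definition unit_cube (R : realType) (d : nat) : set 'rV[R]_d :=
  [set x | forall i, 0 <= x ord0 i <= 1].

Record homothety (R : realType) (d : nat) := Homothety {
  hratio : R;
  hshift : 'rV[R]_d;
  hratio_gt0 : 0 < hratio }.

Definition hmap (R : realType) (d : nat) (h : homothety R d) :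
    'rV[R]_d -> 'rV[R]_d :=
  fun x => hratio h *: x + hshift h.

Definition contracting (R : realType) (d : nat) (h : homothety R d) : Prop :=
  hratio h < 1.

Definition expanding (R : realType) (d : nat) (h : homothety R d) : Prop :=
  1 <= hratio h.

Definition F_miniset (R : realType) (d : nat) (F M : set 'rV[R]_d) : Prop :=
  [/\ M !=set0, compact M &
      exists2 h : homothety R d, expanding h &
        M `<=` @unit_cube R d `&` (hmap h @` F)].

(* The limit is taken in the space of non-empty compact sets. *)
Definition F_microset (R : realType) (d : nat) (F M : set 'rV[R]_d) : Prop :=
  [/\ M !=set0, compact M &
      exists2 A : nat -> set 'rV[R]_d, (forall n, F_miniset F (A n)) &
        hausdorff_dist (A n) M @[n --> \oo] --> 0%E].

Definition weakly_homogeneous (R : realType) (d : nat) (F : set 'rV[R]_d) :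
    Prop :=
  forall M, F_microset F M ->
    exists (n : nat) (A : 'I_n -> set 'rV[R]_d),
      (forall i, F_miniset F (A i)) /\ M = \bigcup_i A i.

Record homothety_ifs (R : realType) (d : nat) := HomothetyIFS {
  ifs_idx : finType;
  ifs_idx_gt0 : (0 < #|ifs_idx|)%N;
  ifs_map : ifs_idx -> homothety R d;
  ifs_contracting : forall i, contracting (ifs_map i) }.

Definition is_attractor (R : realType) (d : nat) (Phi : homothety_ifs R d)
    (F : set 'rV[R]_d) : Prop :=
  [/\ F !=set0, compact F &
      F = \bigcup_(i : ifs_idx Phi) (hmap (ifs_map i) @` F)].

Definition word_map (R : realType) (d : nat) (Phi : homothety_ifs R d)
    (w : seq (ifs_idx Phi)) : 'rV[R]_d -> 'rV[R]_d :=
  foldr (fun i f => hmap (ifs_map i) \o f) id w.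
Arguments word_map {R d} Phi w _.

Definition word_ratio (R : realType) (d : nat) (Phi : homothety_ifs R d)
    (w : seq (ifs_idx Phi)) : R :=
  \prod_(i <- w) hratio (ifs_map i).
Arguments word_ratio {R d} Phi w.

Definition stopping_words (R : realType) (d : nat) (Phi : homothety_ifs R d)
    (rho : R) : set (seq (ifs_idx Phi)) :=
  [set w | w <> [::] /\
           word_ratio Phi w <= rho < word_ratio Phi (take (size w).-1 w)].
Arguments stopping_words {R d} Phi rho _.

(* The counted family is a set of sets, so equal cylinders [word_map Phi w @` F]
   coming from different words are counted once. *)
Definition weak_separation (R : realType) (d : nat) (Phi : homothety_ifs R d)
    (F : set 'rV[R]_d) : Prop :=
  exists c : nat, forall (rho : R) (x : 'rV[R]_d), 0 < rho ->
    [set word_map Phi w @` F | w in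
       [set w | stopping_words Phi rho w /\
                (word_map Phi w @` F) `&` eucl_ball x rho !=set0]] #<= `I_c.

(* Main.v *)
Require Import Defs.
From HB Require Import structures.
From mathcomp Require Import all_boot all_order all_algebra.
From mathcomp Require Import all_classical all_reals all_analysis.
From mathcomp Require Import ring lra.

Set Implicit Arguments.
Unset Strict Implicit.
Unset Printing Implicit Defensive.

Import Order.TTheory GRing.Theory Num.Theory.
Import numFieldNormedType.Exports.

Local Open Scope classical_set_scope.
Local Open Scope card_scope.
Local Open Scope ring_scope.

(* If [A n] lies in the cube and in [h n @` F], then weak separation, applied at a
   scale proportional to the inverse of the ratio of [h n], covers [A n] by a
   number [K], independent of [n], of sets [g n j @` F] where the homotheties
   [g n j] are still expanding and have bounded ratios and translations. By
   compactness [g n j] converges to some [l j] along an ultrafilter, so the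
   Hausdorff limit [M] of [A n] lies in the union of the [l j @` F], and [M] is
   the union of the minisets [M `&` l j @` F]. *)

(** Turns a cardinality bound into a family over a fixed index type by inverting the injection;
    indices outside its image get a default element of [S]. *)
Lemma card_le_II_surj (T : choiceType) (S : set T) (c : nat) :
  S #<= `I_c -> S !=set0 ->
  exists e : 'I_c.+1 -> T, (forall j, S (e j)) /\
    (forall E, S E -> exists j, e j = E).
Proof.
move=> /pcard_leP [f] [E0 SE0].
have [e eP] : {e : 'I_c.+1 -> T & forall j : 'I_c.+1, S (e j) /\
    forall E, S E -> f E = j -> e j = E}.
  apply: (@choice _ _ (fun (j : 'I_c.+1) y => S y /\
    forall E, S E -> f E = j -> y = E)) => j.
  have [[E [SE fE]]|nE] := pselect (exists E, S E /\ f E = j).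
    exists E; split=> // E' SE' fE'.
    by apply: (@inj _ _ S f); [exact: mem_set|exact: mem_set|exact: etrans fE (esym fE')].
  by exists E0; split=> // E SE fE; exfalso; apply: nE; exists E.
exists e; split=> [j|E SE]; first by have [] := eP j.
have fEc : (f E < c.+1)%N by apply: ltnW; rewrite ltnS; apply: (@funS _ _ S _ f).
by exists (Ordinal fEc); apply: (eP (Ordinal fEc)).2.
Qed.

(* The library's [ultra_image] pushes ultrafilters forward by direct images and
   hence only along surjections. *)
Lemma ultra_fmap (T U : Type) (f : T -> U) (F : set_system T) :
  UltraFilter F -> UltraFilter (f @ F).
Proof.
move=> FU; split=> [|G GF FG]; first exact: fmap_proper_filter.
rewrite predeqE => A; split; last exact: FG.
move=> GA; have [//|UnA] := in_ultra_setVsetC (f @^-1` A) FU.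
have GnA : G (~` A) by exact: FG.
by have [? []] := filter_ex (filterI GA GnA).
Qed.

(** * Norm estimates, Hausdorff limits and limits of homotheties *)

Section Distance.
Variables (R : realType) (d : nat).
Implicit Types (x y : 'rV[R]_d) (A : set 'rV[R]_d) (h k : homothety R d).

Lemma coord_le_norm x i : `|x ord0 i| <= `|x|.
Proof. by rewrite [leRHS]mx_normrE (le_bigmax _ _ (ord0, i)). Qed.

Lemma coord_le_eucl x y i : `|x ord0 i - y ord0 i| <= eucl_dist x y.
Proof.
rewrite -sqrtr_sqr; apply: ler_wsqrtr; rewrite (bigD1 i)//= lerDl.
by apply: sumr_ge0 => j _; apply: sqr_ge0.
Qed.

Lemma norm_le_eucl x y : `|x - y| <= eucl_dist x y.
Proof.
rewrite [leLHS]mx_normrE; apply: bigmax_le => [|[i j] _]; first exact: sqrtr_ge0.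
by rewrite (ord1 i) !mxE coord_le_eucl.
Qed.

Lemma eucl_dist_hmap h x y :
  eucl_dist (hmap h x) (hmap h y) = hratio h * eucl_dist x y.
Proof.
have r0 := ltW (hratio_gt0 h).
have -> : hratio h * eucl_dist x y =
    Num.sqrt (hratio h ^+ 2) * eucl_dist x y by rewrite sqrtr_sqr ger0_norm.
rewrite -sqrtrM ?sqr_ge0// mulr_sumr; congr Num.sqrt; apply: eq_bigr => i _.
by rewrite !mxE; ring.
Qed.

Lemma eucl_dist_unit_cube x :
  unit_cube x -> eucl_dist 0 x <= Num.sqrt d%:R.
Proof.
move=> Qx; apply: ler_wsqrtr.
rewrite -[leRHS]mulr1 -[d in leRHS]card_ord mulr_natl -sumr_const.
by apply: ler_sum => i _; have := Qx i; rewrite mxE sub0r sqrrN => /andP[? ?]; nra.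
Qed.

Lemma closure_norm A x :
  (forall e : R, 0 < e -> exists2 a, A a & `|x - a| < e) -> closure A x.
Proof.
move=> Ax B /nbhs_normP[e /= e0 eB]; have [a Aa xa] := Ax e e0.
by exists a; split=> //; apply: eB.
Qed.

Lemma closed_unit_cube : closed (@unit_cube R d).
Proof.
move=> x xQ i.
have Qe (e : R) : 0 < e -> - e <= x ord0 i <= 1 + e.
  move=> e0; have [a [Qa]] := xQ _ (nbhsx_ballx x e e0).
  rewrite -ball_normE /= => xa.
  have /andP[a0 a1] := Qa i.
  have := le_lt_trans (coord_le_norm (x - a) i) xa.
  by rewrite !mxE ltr_norml => /andP[? ?]; apply/andP; split; lra.
apply/andP; split; apply/ler_addgt0Pr => e /Qe /andP[? ?]; lra.
Qed.

Lemma hmap_continuous h : continuous (hmap h).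
Proof.
move=> x; exact: (cvgD (@scaler_continuous R 'rV[R]_d (hratio h) x) (cvg_cst (hshift h))).
Qed.

Lemma compact_hmap h A : compact A -> compact (hmap h @` A).
Proof.
move=> cA; apply: continuous_compact => //.
exact/continuous_subspaceT/hmap_continuous.
Qed.

(** The second term of the maximum controls the distance from each point of [A] to [B n], and the
    Euclidean distance dominates the norm. *)
Lemma near_hausdorff (B : nat -> set 'rV[R]_d) A x :
  hausdorff_dist (B n) A @[n --> \oo] --> 0%E -> A x ->
  forall e : R, 0 < e -> \forall n \near \oo, exists2 b, B n b & `|x - b| < e.
Proof.
move=> BA Ax e e0.
have : \forall n \near \oo, (hausdorff_dist (B n) A < e%:E)%E.
  exact: (BA _ (@nbhs_open_ereal_lt _ 0 (fun=> e) e0)).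
apply: filterS => n; rewrite gt_max => /andP[_ hn].
have : (dist_to_set x (B n) < e%:E)%E.
  by apply: le_lt_trans hn; apply: ereal_sup_ubound; exists x.
move=> /ereal_inf_lt[_ [b Bb <-]]; rewrite lte_fin => xb.
by exists b => //; apply: le_lt_trans xb; apply: norm_le_eucl.
Qed.

(* Homotheties with bounded ratio and translation form a relatively compact set;
   the ultrafilter selects a limit without extracting subsequences. *)
Lemma homothety_ultra_cvg (U : set_system nat) (g : nat -> homothety R d) (t B : R) :
  UltraFilter U ->
  (\forall n \near U, 1 <= hratio (g n) <= t /\ `|hshift (g n)| <= B) ->
  exists2 h, expanding h &
    hratio (g n) @[n --> U] --> hratio h /\ hshift (g n) @[n --> U] --> hshift h.
Proof.
move=> UU gB.
have [r [/= r1 gr]] : `[1, t] `&` [set p | hratio (g n) @[n --> U] --> p] !=set0.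
  have := @segment_compact R 1 t; rewrite compact_ultra; apply; first exact: ultra_fmap.
  by apply: filterS gB => n []; rewrite /= in_itv.
have [v [_ gv]] : [set v : 'rV[R]_d | forall i, `[- B, B]%classic (v ord0 i)] `&`
    [set p | hshift (g n) @[n --> U] --> p] !=set0.
  have := rV_compact (fun i : 'I_d => @segment_compact R (- B) B).
  rewrite compact_ultra; apply; first exact: ultra_fmap.
  apply: filterS gB => n [_ sB] i; rewrite /= in_itv/= -ler_norml.
  exact: le_trans (coord_le_norm _ _) sB.
(* Ratios at least 1 cannot degenerate to 0 in the limit, so the limit parameters again form a
   homothety. *)
have r1' : 1 <= r by move: r1; rewrite in_itv => /andP[].
by exists (Homothety v (lt_le_trans ltr01 r1')).
Qed.

(* Uniform convergence on bounded sets of homotheties with converging parameters. *)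
Lemma homothety_cvg_unif (U : set_system nat) (g : nat -> homothety R d) h (B e : R) :
  Filter U -> 0 < e ->
  hratio (g n) @[n --> U] --> hratio h -> hshift (g n) @[n --> U] --> hshift h ->
  \forall n \near U, forall x, `|x| <= B -> `|hmap h x - hmap (g n) x| < e.
Proof.
move=> UF e0 gr gs.
(* [B] may be zero or negative, hence the absolute value plus one; the halves of [e] go to the ratio
   term and the translation term. *)
have e1 : 0 < e / 2 / (`|B| + 1) by rewrite !divr_gt0// ltr_wpDl.
have e2 : 0 < e / 2 by rewrite divr_gt0.
near=> n => x xB.
have -> : hmap h x - hmap (g n) x =
    (hratio h - hratio (g n)) *: x + (hshift h - hshift (g n)).
  by rewrite /hmap scalerBl opprD addrACA.
apply: le_lt_trans (ler_normD _ _) _; rewrite normrZ [e]splitr.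
apply: ltr_leD; last first.
  by apply: ltW; near: n; exact: cvgr_dist_lt.
have B1 : 0 < `|B| + 1 by rewrite ltr_wpDl.
have rn : `|hratio h - hratio (g n)| < e / 2 / (`|B| + 1).
  by near: n; exact: cvgr_dist_lt.
have xB1 : `|x| <= `|B| + 1.
  by apply: le_trans xB _; apply: le_trans (ler_norm _) _; rewrite lerDl.
have := normr_ge0 (hratio h - hratio (g n)).
rewrite ltr_pdivlMr// in rn => ?.
by apply: le_lt_trans rn; rewrite ler_wpM2l.
Unshelve. all: by end_near. Qed.

Definition hid : homothety R d := @Homothety R d 1 0 ltr01.

Definition hcomp h k : homothety R d :=
  Homothety (hratio h *: hshift k + hshift h) (mulr_gt0 (hratio_gt0 h) (hratio_gt0 k)).

Lemma hmap_id : hmap hid = id.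
Proof. by apply/funext => x; rewrite /hmap/= scale1r addr0. Qed.

Lemma hmap_comp h k : hmap (hcomp h k) = hmap h \o hmap k.
Proof. by apply/funext => x; rewrite /hmap/= scalerDr scalerA addrA. Qed.

(** One known image point controls the translation, which is [hmap h x - hratio h *: x]; this
    supplies the compactness of the covering homotheties. *)
Lemma norm_hshift h x (t b B : R) :
  hratio h <= t -> `|x| <= b -> `|hmap h x| <= B -> `|hshift h| <= B + t * b.
Proof.
move=> ht xb hB; have -> : hshift h = hmap h x - hratio h *: x.
  by rewrite /hmap addrC addKr.
apply: le_trans (ler_normB _ _) (lerD hB _).
by rewrite normrZ ger0_norm ?ler_pM// ltW// hratio_gt0.
Qed.

End Distance.

(** * Stopping words and covers from weak separation *)

Section IFS.
Variables (R : realType) (d : nat) (Phi : homothety_ifs R d).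

Definition word_homothety (w : seq (ifs_idx Phi)) : homothety R d :=
  foldr (fun i h => hcomp (ifs_map i) h) (@hid R d) w.

Lemma hmap_word w : hmap (word_homothety w) = word_map Phi w.
Proof. by elim: w => [|i w IH] /=; rewrite ?hmap_id// hmap_comp IH. Qed.

Lemma hratio_word w : hratio (word_homothety w) = word_ratio Phi w.
Proof.
by elim: w => [|i w IH] /=; rewrite /word_ratio ?big_nil// big_cons -/(word_ratio Phi w) IH.
Qed.

Lemma ifs_ratio_lb : exists2 r : R, 0 < r & forall i : ifs_idx Phi, r <= hratio (ifs_map i).
Proof.
exists (\big[Num.min/1]_i hratio (@ifs_map _ _ Phi i)) => [|i]; last exact: bigmin_le.
by apply: lt_bigmin => // i _; apply: hratio_gt0.
Qed.

Lemma ifs_ratio_ub :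
  exists2 r : R, 0 <= r < 1 & forall i : ifs_idx Phi, hratio (ifs_map i) <= r.
Proof.
exists (\big[Num.max/0]_i hratio (@ifs_map _ _ Phi i)) => [|i]; last exact: le_bigmax.
rewrite bigmax_ge_id/=; apply: bigmax_lt => // i _; exact: ifs_contracting.
Qed.

(** Without its last letter the word has ratio above [rho], and the last letter contributes a factor
    at least [r]. *)
Lemma stopping_ratio_gt (r rho : R) w :
  0 < r -> (forall i : ifs_idx Phi, r <= hratio (ifs_map i)) ->
  stopping_words Phi rho w -> rho * r < word_ratio Phi w.
Proof.
move=> r0 rP [w0 /andP[_]].
case/lastP: w w0 => // w i _.
rewrite size_rcons/= -cats1 take_size_cat// /word_ratio big_cat/= big_seq1 => rw.
apply: lt_le_trans (ler_wpM2l _ (rP i)).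
  by rewrite ltr_pM2r.
by rewrite -/(word_ratio Phi w) -hratio_word ltW// hratio_gt0.
Qed.

Variable F : set 'rV[R]_d.
Hypothesis hF : is_attractor Phi F.

(** Induction on an exponent with [r ^+ n <= rho]: peeling off the first letter divides [rho] by its
    ratio, which uses up one factor [r]. The case [n = 0] contradicts [rho < 1]. *)
Lemma stopping_words_cover (rho : R) x : 0 < rho -> rho < 1 -> F x ->
  exists2 w, stopping_words Phi rho w & (word_map Phi w @` F) x.
Proof.
move=> rho0 rho1 Fx; have [r /andP[r0 r1] rP] := ifs_ratio_ub.
have [n rn] : exists n, r ^+ n <= rho.
  have : \forall n \near \oo, `|0 - r ^+ n| < rho.
    by apply: cvgr_dist_lt rho0; apply: cvg_expr; rewrite ger0_norm.
  move=> [n _ /(_ n (leqnn n))]; rewrite /= sub0r normrN => /ltW h.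
  by exists n; apply: le_trans (ler_norm _) h.
elim: n rho x rho0 rho1 rn Fx => [|n IH] rho x rho0 rho1 rn Fx.
  by move: rn; rewrite expr0 leNgt rho1.
have [_ _ FE] := hF; move: (Fx); rewrite {1}FE => -[i _ [y Fy yx]].
have i0 := hratio_gt0 (ifs_map i).
(* A first letter of ratio at most [rho] already stops, since the empty word has ratio [1 > rho]. *)
have [ri|ri] := leP (hratio (ifs_map i)) rho.
  exists [:: i]; last by exists y.
  by split=> //=; rewrite /word_ratio big_seq1 big_nil ri.
have [||||w [w0 /andP[w1 w2]] [z Fz zy]] := IH (rho / hratio (ifs_map i)) y.
- by rewrite divr_gt0.
- by rewrite ltr_pdivrMr ?mul1r.
- rewrite ler_pdivlMr//; apply: le_trans rn; rewrite exprSr.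
  by rewrite ler_wpM2l ?exprn_ge0.
- exact: Fy.
exists (i :: w); last by exists z => //; rewrite /= zy.
(* As the tail is nonempty, deleting the last letter of [i :: w] leaves [i] in front. *)
split=> //; case: w w0 w1 w2 {zy} => // j w _ w1 w2.
have consE v : word_ratio Phi (i :: v) = word_ratio Phi v * hratio (ifs_map i).
  by rewrite /word_ratio big_cons mulrC.
rewrite [take _ _]/= !consE -ler_pdivlMr// w1 -ltr_pdivrMr//.
Qed.

Hypothesis hWSC : weak_separation Phi F.

(* By rescaling, the cylinders of size comparable to the preimage of the cube
   become expanded copies of [F], and weak separation bounds their number. *)
Lemma expanding_cover : exists (K : nat) (t B : R),
  forall h : homothety R d, expanding h -> (@unit_cube R d `&` (hmap h @` F)) !=set0 ->
  exists g : 'I_K -> homothety R d,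
    (forall j, 1 <= hratio (g j) <= t /\ `|hshift (g j)| <= B) /\
    @unit_cube R d `&` (hmap h @` F) `<=` \bigcup_j (hmap (g j) @` F).
Proof.
have [_ cF _] := hF.
have [b bF] : exists b : R, forall x, F x -> `|x| <= b.
  have [b [_ bP]] := compact_bounded cF.
  by exists (b + 1); apply: bP; rewrite ltrDl.
have [r r0 rP] := ifs_ratio_lb.
have [c cP] := hWSC.
(* The summand [r^-1] gives [1 <= t * r], which keeps the rescaled cylinders expanding; the others
   put the cube inside the open ball of radius [t] about the origin. *)
pose t : R := r^-1 + Num.sqrt d%:R + 1.
have rV0 : 0 < r^-1 by rewrite invr_gt0.
have sd0 : 0 <= Num.sqrt d%:R :> R by exact: sqrtr_ge0.
have t0 : 0 < t by rewrite /t; lra.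
have tr : 1 <= t * r.
  have : r^-1 * r <= t * r by rewrite ler_pM2r// /t; lra.
  by rewrite mulVf// gt_eqF.
have Qt (x : 'rV[R]_d) : unit_cube x -> eucl_dist 0 x < t.
  by move=> /eucl_dist_unit_cube xd; rewrite /t; lra.
have shiftB (k : homothety R d) y : F y -> hratio k <= t ->
    eucl_dist 0 (hmap k y) < t -> `|hshift k| <= t + t * b.
  move=> Fy kt yt; apply: (norm_hshift kt (bF _ Fy)).
  rewrite -normrN -sub0r; apply: le_trans (norm_le_eucl _ _) (ltW yt).
exists c.+1, t, (t + t * b) => h h1 [p0 [Qp0 Fp0]].
have s0 := hratio_gt0 h.
(* If the ratio of [h] is at most [t], then [h] alone serves; otherwise [t / hratio h < 1], as
   [stopping_words_cover] requires. *)
have [st|st] := leP (hratio h) t.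
  exists (fun=> h); split=> [_|p [_ Fp]]; last by exists ord0.
  rewrite h1 st; split=> //; have [y Fy yp] := Fp0.
  by apply: (shiftB _ y) => //; rewrite yp; apply: Qt.
pose rho := t / hratio h.
have rho0 : 0 < rho by rewrite divr_gt0.
have rho1 : rho < 1 by rewrite ltr_pdivrMr ?mul1r.
(* [h] carries the ball of radius [rho] about [x0] to the ball of radius [t] about the origin, so
   every cylinder whose image under [h] meets the cube is counted by weak separation. *)
pose x0 : 'rV[R]_d := - ((hratio h)^-1 *: hshift h).
have hx0 : hmap h x0 = 0.
  by rewrite /hmap scalerN scalerA divff ?gt_eqF// scale1r addNr.
have ballE y : eucl_ball x0 rho y = (eucl_dist 0 (hmap h y) < t) :> Prop.
  rewrite /eucl_ball/= -hx0 eucl_dist_hmap /rho ltr_pdivlMr//.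
  by rewrite [X in _ = is_true (X < _)]mulrC.
pose W := [set w | stopping_words Phi rho w /\
                (word_map Phi w @` F) `&` eucl_ball x0 rho !=set0].
have cov p : (@unit_cube R d `&` (hmap h @` F)) p -> exists2 w, W w &
    (hmap (hcomp h (word_homothety w)) @` F) p.
  move=> [Qp [y Fy yp]].
  have [w sw [z Fz zy]] := stopping_words_cover rho0 rho1 Fy.
  exists w; last by exists z => //; rewrite hmap_comp hmap_word/= zy.
  by split=> //; exists y; split; [exists z|rewrite ballE yp; exact: Qt].
have [|e [eS Se]] := card_le_II_surj (cP rho x0 rho0).
  by have [w Ww _] := cov p0 (conj Qp0 Fp0); exists (word_map Phi w @` F); exists w.
have /choice[v vP] : forall j, exists w, W w /\ word_map Phi w @` F = e j.
  by move=> j; have [w Ww wE] := eS j; exists w.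
exists (fun j => hcomp h (word_homothety (v j))); split=> [j|p Qp].
  have [[sw [_ [[y Fy <-] yball]]] _] := vP j.
  have gt : hratio (hcomp h (word_homothety (v j))) <= t.
    rewrite /= hratio_word mulrC -ler_pdivlMr//.
    by have [_ /andP[]] := sw.
  split; last first.
    by apply: (shiftB _ y) => //; rewrite hmap_comp hmap_word /= -ballE.
  rewrite gt andbT/= hratio_word; apply: le_trans tr _.
  have := ltW (stopping_ratio_gt r0 rP sw).
  by rewrite /rho mulrAC ler_pdivrMr// mulrC [leRHS]mulrC.
(* The word [w] need not be one of the chosen [v j]; equality of the cylinders as sets supplies
   another preimage [z'] through [v j]. *)
have [w Ww] := cov p Qp.
have [j ej] := Se (word_map Phi w @` F) (ex_intro2 _ _ w Ww erefl).
have [_ vE] := vP j.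
move=> [z Fz zp]; have : e j (word_map Phi w z) by rewrite ej; exists z.
rewrite -vE => -[z' Fz' zz']; exists j => //; exists z' => //.
by rewrite -zp !hmap_comp !hmap_word/= zz'.
Qed.

End IFS.

(** * Decomposition of a microset into minisets *)

Theorem proposition5p9 (R : realType) (d : nat) (Phi : homothety_ifs R d)
    (F : set 'rV[R]_d) (hF : is_attractor Phi F)
    (hWSC : weak_separation Phi F) :
  weakly_homogeneous F.
Proof.
move=> M [[m0 Mm0] cM [A Amin AM]].
have [_ cF _] := hF.
have [K [t [B coverP]]] := expanding_cover hF hWSC.
have [b bF] : exists b : R, forall x, F x -> `|x| <= b.
  have [b [_ bP]] := compact_bounded cF.
  by exists (b + 1); apply: bP; rewrite ltrDl.
have /choice[g gP] : forall n, exists g : 'I_K -> homothety R d,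
    (forall j, 1 <= hratio (g j) <= t /\ `|hshift (g j)| <= B) /\
    A n `<=` \bigcup_j (hmap (g j) @` F).
  move=> n; have [[a Aa] _ [h h1 Ah]] := Amin n.
  have [|g [gB hg]] := coverP h h1; first by exists a; apply: Ah.
  by exists g; split=> // p /Ah/hg.
have AQ n : A n `<=` @unit_cube R d by have [_ _ [h _ Ah]] := Amin n => p /Ah[].
(* A single ultrafilter makes all [K] sequences converge at once and retains every eventual
   property. *)
have [U [UU oU]] := ultraFilterLemma eventually_filter.
have /choice[l lP] : forall j, exists l : homothety R d, expanding l /\
    (hratio (g n j) @[n --> U] --> hratio l /\ hshift (g n j) @[n --> U] --> hshift l).
  move=> j; have [|l l1 lP] := @homothety_ultra_cvg _ _ U (fun n => g n j) t B UU.
    by apply: filterE => n; have [+ _] := gP n; apply.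
  by exists l.
have nearM x (e : R) : M x -> 0 < e ->
    \forall n \near U, exists2 a, A n a & `|x - a| < e.
  by move=> Mx e0; apply: oU; apply: near_hausdorff AM Mx e e0.
have MQ : M `<=` @unit_cube R d.
  move=> x Mx; apply: closed_unit_cube; apply: closure_norm => e e0.
  have [n [a Aa xa]] := filter_ex (nearM x e Mx e0).
  by exists a => //; apply: AQ Aa.
have lcl j : closed (hmap (l j) @` F).
  by apply: compact_closed; [exact: norm_hausdorff|exact: compact_hmap].
have Ucl : closed (\bigcup_j (hmap (l j) @` F)).
  by apply: closed_bigcup => *; [exact: finite_finset|exact: lcl].
(* The index [j] covering the nearby point [a] depends on [n]; closeness uniform over all [j] makes
   this harmless, since the finite union is closed. *)
have Ml : M `<=` \bigcup_j (hmap (l j) @` F).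
  move=> x Mx; apply: Ucl; apply: closure_norm => e e0.
  have e2 : 0 < e / 2 by rewrite divr_gt0.
  have unif : \forall n \near U, forall j y, `|y| <= b ->
      `|hmap (l j) y - hmap (g n j) y| < e / 2.
    by apply: filter_forall => j; have [_ [? ?]] := lP j; apply: homothety_cvg_unif.
  have [n [[a Aa xa] gl]] := filter_ex (filterI (nearM x (e / 2) Mx e2) unif).
  have [_ /(_ a Aa) [j _ [y Fy ya]]] := gP n.
  exists (hmap (l j) y); first by exists j => //; exists y.
  rewrite [e]splitr (le_lt_trans (ler_distD a _ _))// ltrD//.
  by rewrite distrC -ya gl// bF.
have [j0 _ M0] := Ml _ Mm0.
pose P j := M `&` (hmap (l j) @` F).
(* A miniset is non-empty but [P j] may be empty; such pieces are replaced by [P j0], which contains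
   [m0]. *)
exists K, (fun j => if `[< P j !=set0 >] then P j else P j0); split.
  have Pmin j : P j !=set0 -> F_miniset F (P j).
    move=> Pj; split=> //; first exact: compact_closedI.
    by exists (l j) => [|x [/MQ ? ?]]; [have [] := lP j|split].
  move=> j; case: asboolP => [|_]; apply: Pmin => //.
  by exists m0.
apply/seteqP; split=> [x Mx|x [j _]]; last by case: asboolP => _ [].
have [j _ lx] := Ml _ Mx; exists j => //.
by rewrite asboolT//; exists x.
Qed.
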